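(* Let $\mathcal{X}$ be a nonempty finite set with $N=|\mathcal{X}|$, and let $\{\rho_x\}_{x\in\mathcal{X}}$ be density operators on a finite-dimensional Hilbert space $\mathcal{H}$. Let $\mathcal{Q}(X\to A)_\rho$ be the maximal quantum leakage of the family $\{\rho_x\}_{x\in\mathcal{X}}$, and let $P_{\mathrm{guess}}$ be the optimal success probability of minimum-error discrimination of the states $\{\rho_x\}_{x\in\mathcal{X}}$ with uniform prior $q_x=1/N$. Then $$\mathcal{Q}(X\to A)_\rho=\log\big(N\,P_{\mathrm{guess}}\big).$$
   Context: A density operator is a positive semidefinite operator of unit trace. A POVM on $\mathcal{H}$ with finite outcome set $\mathcal{Y}$ is a family $\{F_y\}_{y\in\mathcal{Y}}$ of operators with $F_y\ge0$ and $\sum_y F_y=I$. $\log$ is the natural logarithm. Maximal quantum leakage: $$\mathcal{Q}(X\to A)_\rho=\max_{\{F_y\}_{y\in\mathcal{Y}}}\log\Big(\sum_{y\in\mathcal{Y}}\max_{x\in\mathcal{X}}\mathrm{Tr}(\rho_xF_y)\Big),$$ the maximum being over all POVMs $\{F_y\}_{y\in\mathcal{Y}}$ on $\mathcal{H}$ with arbitrary finite outcome set $\mathcal{Y}$. Minimum-error discrimination with prior $\{q_x\}$: $$P_{\mathrm{guess}}=\max_{\{M_x\}_{x\in\mathcal{X}}}\sum_{x\in\mathcal{X}}q_x\,\mathrm{Tr}(M_x\rho_x),$$ the maximum being over all POVMs $\{M_x\}_{x\in\mathcal{X}}$ on $\mathcal{H}$ indexed by $\mathcal{X}$; here $q_x=1/N$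 for all $x$. *)

(* Defs.v *)
From mathcomp Require Import all_boot all_order all_algebra.
From mathcomp Require Import complex.
From mathcomp Require Import all_classical all_reals all_analysis.

Set Implicit Arguments.
Unset Strict Implicit.
Unset Printing Implicit Defensive.

Import Order.TTheory GRing.Theory Num.Theory.
Local Open Scope classical_set_scope.
Local Open Scope ring_scope.
Local Open Scope complex_scope.
Local Open Scope sesquilinear_scope.

(* Operators on the Hilbert space C^n are matrices acting on column vectors.
   On R[i], [0 <= z] means that z is real and nonnegative. *)
Definition psdmx (R : realType) (n : nat) (A : 'M[R[i]]_n) : Prop :=
  A \is hermsymmx /\ forall v : 'cV[R[i]]_n, 0 <= (v^t* *m A *m v) 0 0.

Definition density (R : realType) (n : nat) (rho : 'M[R[i]]_n) : Prop :=
  psdmx rho /\ \tr rho = 1.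

Definition povm (R : realType) (n : nat) (Y : finType)
    (F : Y -> 'M[R[i]]_n) : Prop :=
  (forall y, psdmx (F y)) /\ \sum_y F y = 1%:M.

(* Tr(A B) is real for positive semidefinite A and B, so taking the real part
   only changes its type. *)
Definition retr (R : realType) (n : nat) (A B : 'M[R[i]]_n) : R :=
  complex.Re (\tr (A *m B)).

Definition is_max (R : realType) (S : set R) (m : R) : Prop :=
  S m /\ ubound S m.

(* The base point 0 of the maximum over x is harmless: Tr(rho_x F_y) >= 0. *)
Definition leakage_values (R : realType) (n : nat) (X : finType)
    (rho : X -> 'M[R[i]]_n) : set R :=
  [set v | exists (Y : finType) (F : Y -> 'M[R[i]]_n), povm F /\
     v = ln (\sum_y \big[Num.max/0]_x retr (rho x) (F y))].

(* The suprema below are maxima only when they are attained, which has to be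
   established separately as [is_max]. *)
Definition maximal_leakage (R : realType) (n : nat) (X : finType)
    (rho : X -> 'M[R[i]]_n) : R :=
  sup (leakage_values rho).

Definition guess_values (R : realType) (n : nat) (X : finType)
    (q : X -> R) (rho : X -> 'M[R[i]]_n) : set R :=
  [set v | exists M : X -> 'M[R[i]]_n, povm M /\
     v = \sum_x q x * retr (M x) (rho x)].

Definition guess_prob (R : realType) (n : nat) (X : finType)
    (q : X -> R) (rho : X -> 'M[R[i]]_n) : R :=
  sup (guess_values q rho).

Definition uniform_prior (R : realType) (X : finType) (x : X) : R :=
  #|X|%:R^-1.

(* Main.v *)
Require Import Defs.
From mathcomp Require Import all_boot all_order all_algebra.
From mathcomp Require Import complex.
From mathcomp Require Import all_classical all_reals all_analysis.
From mathcomp Require Import lra.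

Import Order.TTheory GRing.Theory Num.Theory.
Import numFieldNormedType.Exports.
Local Open Scope ring_scope.
Local Open Scope complex_scope.

(** Coarsening a POVM [F] on [Y] along a map sending each outcome [y] to a
    maximizer over [x] of [Tr (rho_x F_y)] gives a POVM [M] on [X] with
    [sum_y max_x Tr (rho_x F_y) = sum_x Tr (rho_x M_x)], and the right-hand side
    is [N] times the success probability of [M].  Conversely a guessing POVM,
    read as a measurement with outcome set [X], has a leakage sum at least [N]
    times its success probability.  Hence both maxima are attained at the same
    POVM.  An optimal guessing POVM exists because POVMs indexed by [X] form a
    compact set in their real coordinates. *)

Set Implicit Arguments.
Unset Strict Implicit.
Unset Printing Implicit Defensive.

(** * Positive semidefinite matrices: trace pairing and entry bounds *)

Section Psd.
Local Open Scope sesquilinear_scope.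
Context {R : realType} {n : nat}.
Implicit Types A B : 'M[R[i]]_n.

Lemma hermsymmxE A : (A \is hermsymmx) = (A^t* == A).
Proof. by rewrite qualifE /= expr0 scale1r eq_sym. Qed.

Lemma psdmx_herm A : psdmx A -> A^t* = A.
Proof. by case=> + _; rewrite hermsymmxE => /eqP. Qed.

Lemma quadform_conj A (v : 'cV[R[i]]_n) : A^t* = A ->
  ((v^t* *m A *m v) 0 0)^* = (v^t* *m A *m v) 0 0.
Proof.
move=> hA.
have e : (v^t* *m A *m v)^t* = v^t* *m A *m v.
  by rewrite !trmx_mul !map_mxM trmxCK hA mulmxA.
by rewrite -{2}e !mxE.
Qed.

(** The quadratic form of a Hermitian matrix equals its own conjugate, so its imaginary part
    vanishes and only the sign of the real part has to be tested. *)
Lemma psdmxP A : psdmx A <-> A^t* = A /\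
  forall v : 'cV[R[i]]_n, 0 <= complex.Re ((v^t* *m A *m v) 0 0).
Proof.
split=> [pA|[hA pA]]; last split.
- split; first exact: psdmx_herm.
  by case: pA => _ pA v; move: (pA v); rewrite lecE => /andP[].
- by rewrite hermsymmxE hA.
move=> v; have := quadform_conj v hA; have := pA v.
case: (_ 0 0) => a b /= a0 [] /eqP; rewrite lecE /= a0 andbT.
by rewrite -subr_eq0 -opprD oppr_eq0 -mulr2n mulrn_eq0.
Qed.

(** This diagonal entry is the quadratic form of [A] at the conjugate transpose of row [i] of
    [P]. *)
Lemma psdmx_sandwich_ge0 m (P : 'M[R[i]]_(m, n)) A i : psdmx A ->
  0 <= (P *m A *m P^t*) i i.
Proof.
case=> _ /(_ ((row i P)^t*)); rewrite trmxCK; congr (0 <= _).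
by rewrite -!row_mul !mxE; apply: eq_bigr => k _; rewrite !mxE.
Qed.

(** Diagonalize [A] by a unitary [P] with eigenvalues [d]. By cyclicity the trace is the sum over
    [i] of [d_i] times the [i]-th diagonal entry of [P *m B *m P^t*]. Both factors are nonnegative,
    since [d_i] is itself a diagonal entry of [P *m A *m P^t*]. *)
Lemma psdmx_trace_mul_ge0 A B : psdmx A -> psdmx B -> 0 <= \tr (A *m B).
Proof.
move=> pA pB.
have /hermitian_normalmx/orthomx_spectralP := pA.1.
set P := spectralmx A; set d := spectral_diag A => eA.
have uP : P \is unitarymx by exact: spectral_unitarymx.
have iP := invmx_unitary uP.
have eD : diag_mx d = P *m A *m P^t*.
  rewrite eA iP !mulmxA (unitarymxP uP) mul1mx -mulmxA (unitarymxP uP).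
  by rewrite mulmx1.
rewrite eA iP -!mulmxA mxtrace_mulC -!mulmxA; apply: sumr_ge0 => i _.
rewrite mul_diag_mx mxE mulmxA mulr_ge0 ?psdmx_sandwich_ge0 //.
have := psdmx_sandwich_ge0 P i pA; rewrite -eD !mxE eqxx mulr1n//.
Qed.

Lemma psdmx0 : psdmx (0 : 'M[R[i]]_n).
Proof.
apply/psdmxP; split=> [|v]; first by rewrite trmx0 map_mx0.
by rewrite mulmx0 mul0mx mxE.
Qed.

Lemma psdmx1 : psdmx (1%:M : 'M[R[i]]_n).
Proof.
apply/psdmxP; split=> [|v]; first by rewrite trmx1 map_mx1.
rewrite mulmx1 mxE raddf_sum sumr_ge0 // => i _; rewrite !mxE.
by case: (v i 0) => a b /=; rewrite mulNr opprK addr_ge0 // -expr2 sqr_ge0.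
Qed.

Lemma psdmxD A B : psdmx A -> psdmx B -> psdmx (A + B).
Proof.
move=> /psdmxP[hA pA] /psdmxP[hB pB]; apply/psdmxP; split=> [|v].
  by rewrite linearD /= map_mxD hA hB.
by rewrite mulmxDr mulmxDl mxE raddfD; apply: addr_ge0; [exact: pA|exact: pB].
Qed.

Lemma psdmx_sum (I : finType) (Q : pred I) (F : I -> 'M[R[i]]_n) :
  (forall i, Q i -> psdmx (F i)) -> psdmx (\sum_(i | Q i) F i).
Proof. by move=> pF; apply: big_ind => //; [exact: psdmx0|exact: psdmxD]. Qed.

Lemma quadform_delta2 A (c : R[i]) i j :
  let v : 'cV_n := delta_mx i 0 + c *: delta_mx j 0 in
  (v^t* *m A *m v) 0 0 = A i i + c * A i j + Num.conj c * A j i + `|c| ^+ 2 * A j j.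
Proof.
move=> v; have e k l : (delta_mx 0 k *m A *m delta_mx l 0 : 'M[R[i]]_1) 0 0 = A k l.
  by rewrite -rowE -colE !mxE.
have -> : v^t* = delta_mx 0 i + Num.conj c *: delta_mx 0 j.
  by rewrite /v linearD linearZ /= map_mxD map_mxZ !trmx_delta !map_delta_mx.
rewrite /v !mulmxDl !mulmxDr -!scalemxAl -!scalemxAr.
have aD (M N : 'M[R[i]]_1) : (M + N) 0 0 = M 0 0 + N 0 0 by rewrite mxE.
have aZ k (M : 'M[R[i]]_1) : (k *: M) 0 0 = k * M 0 0 by rewrite mxE.
by rewrite !(aD, aZ, e) normCKC !addrA mulrA.
Qed.

Lemma psdmx_entry_le A i j : psdmx A -> A i i <= 1 -> A j j <= 1 ->
  `|complex.Re (A i j)| <= 1 /\ `|complex.Im (A i j)| <= 1.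
Proof.
(* Positivity is tested on e_i + c e_j for c = 1, -1, i, -i. *)
move=> pA.
have eji : A j i = Num.conj (A i j) by rewrite -{1}(psdmx_herm pA) !mxE.
have q (x y : R) : x ^+ 2 + y ^+ 2 = 1 ->
    0 <= complex.Re (A i i + (x +i* y) * A i j
       + Num.conj (x +i* y) * Num.conj (A i j) + A j j).
  move=> c1; have := quadform_delta2 A (x +i* y) i j.
  rewrite -add_Re2_Im2 /= c1 mul1r -eji => <-.
  by case/psdmxP: pA => _; apply.
have := (q 1 0, q (-1) 0, q 0 1, q 0 (-1)).
case: (A i j) (A i i) (A j j) => [a b] [c d] [e f] /=.
rewrite !lecE /= => -[[[q1 q2] q3] q4] /andP[_ c1] /andP[_ e1].
(* With both diagonal entries at most 1, c = 1 and c = -1 bound the real part from below and above.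
   Since Re(iz) = -Im z, c = -i gives the lower bound on the imaginary part and c = i the upper
   one. *)
rewrite !ler_norml; split; apply/andP; split.
- have := q1 ltac:(lra); lra.
- have := q2 ltac:(lra); lra.
- have := q4 ltac:(lra); lra.
- have := q3 ltac:(lra); lra.
Qed.

End Psd.

(** * POVMs, leakage sums and guessing sums *)

Section Povm.
Context {R : realType} {n : nat}.

(** The entries at position (i, i) are nonnegative and sum to 1 over the outcomes. Combined with
    [psdmx_entry_le], this bounds every entry of a POVM. *)
Lemma povm_diag_le1 (Y : finType) (F : Y -> 'M[R[i]]_n) y i :
  povm F -> F y i i <= 1.
Proof.
case=> pF /matrixP /(_ i i); rewrite summxE !mxE eqxx => sF.
have <- : \sum_y F y i i = 1 by [].
rewrite (bigD1 y)//= lerDl sumr_ge0 // => z _.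
by have := psdmx_sandwich_ge0 1%:M i (pF z); rewrite trmx1 map_mx1 mul1mx mulmx1.
Qed.

Lemma povm_coarsen (X Y : finType) (F : Y -> 'M[R[i]]_n) (g : Y -> X) :
  povm F -> povm (fun x => \sum_(y | g y == x) F y).
Proof.
case=> pF sF; split=> [x|]; first by apply: psdmx_sum.
by rewrite -sF [RHS](partition_big g xpredT).
Qed.

Lemma retrC (A B : 'M[R[i]]_n) : retr A B = retr B A.
Proof. by rewrite /retr mxtrace_mulC. Qed.

Lemma retr_sumr (I : finType) (Q : pred I) A (F : I -> 'M[R[i]]_n) :
  retr A (\sum_(i | Q i) F i) = \sum_(i | Q i) retr A (F i).
Proof. by rewrite /retr mulmx_sumr (raddf_sum (@mxtrace _ _)) raddf_sum. Qed.

Lemma retr_ge0 (A B : 'M[R[i]]_n) : psdmx A -> psdmx B -> 0 <= retr A B.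
Proof.
by move=> pA /(psdmx_trace_mul_ge0 pA); rewrite lecE => /andP[].
Qed.

Lemma povm_leakage_sum_guess (X Y : finType) (rho : X -> 'M[R[i]]_n)
    (F : Y -> 'M[R[i]]_n) : (0 < #|X|)%N -> (forall x, psdmx (rho x)) ->
  povm F -> exists2 M : X -> 'M[R[i]]_n, povm M &
    \sum_y \big[Num.max/0]_x retr (rho x) (F y) = \sum_x retr (M x) (rho x).
Proof.
move=> /card_gt0P[x0 _] prho pF.
(* The terms are nonnegative, so the base value 0 never exceeds them and the maximum is attained at
   some [x]. *)
have /all_sig[g gE] y : {x | \big[Num.max/0]_x retr (rho x) (F y)
                             = retr (rho x) (F y)}.
  have [|x _ ->] := @eq_bigmax _ _ _ 0 x0 xpredT (fun x => retr (rho x) (F y))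
    isT; last by exists x.
  by move=> x _; exact: retr_ge0 (prho x) (pF.1 y).
exists (fun x => \sum_(y | g y == x) F y); first exact: povm_coarsen.
under eq_bigr do rewrite gE.
rewrite (partition_big g xpredT) //=; apply: eq_bigr => x _.
by rewrite retrC retr_sumr; apply: eq_bigr => y /eqP->.
Qed.

Lemma guess_le_leakage_sum (X : finType) (rho M : X -> 'M[R[i]]_n) :
  \sum_x retr (M x) (rho x) <= \sum_y \big[Num.max/0]_x retr (rho x) (M y).
Proof.
apply: ler_sum => x _; rewrite retrC.
exact: (le_bigmax _ (fun z => retr (rho z) (M x))).
Qed.

(** For a fixed [x0] the numbers Tr(rho_x0 F_y) already sum to Tr(rho_x0) = 1. The bound keeps the
    argument of the logarithm positive. *)
Lemma leakage_sum_ge1 (X Y : finType) (rho : X -> 'M[R[i]]_n)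
    (F : Y -> 'M[R[i]]_n) : (0 < #|X|)%N -> (forall x, density (rho x)) ->
  povm F -> 1 <= \sum_y \big[Num.max/0]_x retr (rho x) (F y).
Proof.
move=> /card_gt0P[x0 _] drho pF.
apply: (@le_trans _ _ (\sum_y retr (rho x0) (F y))).
  by rewrite -retr_sumr pF.2 /retr mulmx1 (drho x0).2.
by apply: ler_sum => y _; exact: (le_bigmax _ (fun z => retr (rho z) (F y))).
Qed.

Lemma povm_exists (X : finType) : (0 < #|X|)%N ->
  exists M : X -> 'M[R[i]]_n, povm M.
Proof.
move=> /card_gt0P[x0 _].
(* The one-outcome POVM given by the identity, coarsened along the constant map to [x0]. *)
exists (fun x => \sum_(y : unit | x0 == x) 1%:M).
apply: (@povm_coarsen X unit (fun=> 1%:M) (fun=> x0)).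
by split=> [_|]; [exact: psdmx1|rewrite big_const card_unit /= addr0].
Qed.

End Povm.

Lemma is_max_sup (R : realType) (S : set R) m : is_max S m -> sup S = m.
Proof.
move=> [Sm ubm]; apply/eqP; rewrite eq_le ge_sup //=; last by exists m.
by rewrite ub_le_sup //; exists m.
Qed.

(** * Compactness of the set of POVMs and existence of an optimal guess *)

Section Compactness.
Local Open Scope classical_set_scope.
Local Open Scope sesquilinear_scope.
Context {R : realType} {n : nat} {X : finType}.

(** Operator families are encoded as real functions on a finite index set, the Boolean selecting the
    real part ([false]) or the imaginary part ([true]), so that Tychonoff's theorem applies to the
    product of real lines. *)
Local Notation coord := (X * 'I_n * 'I_n * bool)%type.
Local Notation space := {ptws coord -> R}.

Definition opfam_of_coord (f : space) (x : X) : 'M[R[i]]_n :=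
  \matrix_(i, j) (f (x, i, j, false) +i* f (x, i, j, true)).

Definition coord_of_opfam (M : X -> 'M[R[i]]_n) : space :=
  fun t => let: (x, i, j, b) := t in
    if b then complex.Im (M x i j) else complex.Re (M x i j).

Lemma coord_of_opfamK M : opfam_of_coord (coord_of_opfam M) = M.
Proof.
by apply/funext => x; apply/matrixP => i j; rewrite mxE /=; case: (M x i j).
Qed.

Lemma continuous_coord (t : coord) : continuous (fun f : space => f t).
Proof. exact: (@proj_continuous _ (fun=> R) t). Qed.

Lemma continuous_sumr (T : topologicalType) (I : finType) (F : I -> T -> R) :
  (forall i, continuous (F i)) -> continuous (fun t => \sum_i F i t).
Proof.
by move=> cF; apply: continuous_big => //; exact: add_continuous.
Qed.

Lemma continuous_subr (T : topologicalType) (g h : T -> R) :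
  continuous g -> continuous h -> continuous (fun t => g t - h t).
Proof. by move=> cg ch t; apply: cvgB; [exact: cg|exact: ch]. Qed.

Lemma continuous_mulr (T : topologicalType) (g h : T -> R) :
  continuous g -> continuous h -> continuous (fun t => g t * h t).
Proof. by move=> cg ch t; apply: cvgM; [exact: cg|exact: ch]. Qed.

(** For fixed [B] the real part of the trace is a finite real linear combination of the coordinates
    of [f]. *)
Lemma continuous_retr x (B : 'M[R[i]]_n) :
  continuous (fun f : space => retr (opfam_of_coord f x) B).
Proof.
have -> : (fun f : space => retr (opfam_of_coord f x) B) = fun f =>
    \sum_i \sum_j (f (x, i, j, false) * complex.Re (B j i)
                   - f (x, i, j, true) * complex.Im (B j i)).
  apply/funext => f; rewrite /retr raddf_sum; apply: eq_bigr => i _.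
  rewrite mxE raddf_sum; apply: eq_bigr => j _; rewrite mxE.
  by case: (B j i).
apply: continuous_sumr => i; apply: continuous_sumr => j.
by apply: continuous_subr; apply: continuous_mulr;
   [exact: continuous_coord|exact: cst_continuous
   |exact: continuous_coord|exact: cst_continuous].
Qed.

Lemma closed_all (T : topologicalType) (I : Type) (P : I -> set T) :
  (forall i, closed (P i)) -> closed [set t | forall i, P i t].
Proof.
move=> cP; rewrite (_ : mkset _ = \bigcap_(i in setT) P i).
  by apply: closed_bigI.
by apply/seteqP; split=> [t h i _|t h i]; exact: h.
Qed.

Lemma closed_eq_continuous (T : topologicalType) (g h : T -> R) :
  continuous g -> continuous h -> closed [set t | g t = h t].
Proof.
move=> cg ch; rewrite (_ : mkset _ = (fun t => g t - h t) @^-1` [set x | x = 0]).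
  apply: preimage_closed; last exact: closed_eq.
  by move=> t _; exact: continuous_subr.
apply/seteqP; split=> t /= e; first by rewrite e subrr.
by apply/eqP; rewrite -subr_eq0 e.
Qed.

Lemma closed_ge0_continuous (T : topologicalType) (g : T -> R) :
  continuous g -> closed [set t | 0 <= g t].
Proof.
move=> cg; rewrite (_ : mkset _ = g @^-1` [set x | 0 <= x]) //.
apply: preimage_closed; last exact: closed_ge.
by move=> t _; exact: cg.
Qed.

Lemma sum_opfam_of_coord (f : space) i j :
  \sum_x opfam_of_coord f x i j =
  (\sum_x f (x, i, j, false)) +i* (\sum_x f (x, i, j, true)).
Proof.
apply/eqP; rewrite eq_complex !raddf_sum /=.
by apply/andP; split; apply/eqP; apply: eq_bigr => x _; rewrite mxE.
Qed.

Definition povm_coords : set space := [set f | povm (opfam_of_coord f)].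

Lemma povm_coordsE : povm_coords =
  [set f : space | forall t : coord, let: (x, i, j, b) := t in
     f (x, j, i, b) = (-1) ^+ b * f (x, i, j, b)] `&`
  [set f : space | forall xv : X * 'cV[R[i]]_n,
     0 <= retr (opfam_of_coord f xv.1) (xv.2 *m xv.2^t*)] `&`
  [set f : space | forall t : 'I_n * 'I_n * bool,
     \sum_x f (x, t.1.1, t.1.2, t.2) = (~~ t.2 && (t.1.1 == t.1.2))%:R].
Proof.
apply/seteqP; split=> f.
- move=> [pf sf]; split; [split|].
  + case=> [[[x i] j] b]; have := psdmx_herm (pf x).
    move=> /matrixP/(_ j i); rewrite !mxE /= => -[e1 e2].
    by case: b; rewrite (expr0, expr1) (mul1r, mulN1r).
  + case=> x v /=; have /psdmxP[_ /(_ v)] := pf x.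
    by rewrite /retr mulmxA mxtrace_mulC mulmxA -trace_mx11.
  + case=> [[i j] b] /=; move/matrixP: sf => /(_ i j).
    rewrite summxE !mxE sum_opfam_of_coord.
    by case: (i == j); case: b => -[].
- move=> [[h1 h2] h3]; split.
  + move=> x; apply/psdmxP; split.
      apply/matrixP => i j; rewrite !mxE /=.
      have := (h1 (x, i, j, false), h1 (x, i, j, true)).
      rewrite expr0 expr1 mul1r mulN1r => -[-> ->].
      by apply/eqP; rewrite eq_complex /= opprK !eqxx.
    move=> v; have := h2 (x, v).
    by rewrite /retr mulmxA mxtrace_mulC mulmxA -trace_mx11.
  + apply/matrixP=> i j; rewrite summxE !mxE sum_opfam_of_coord.
    have := (h3 (i, j, false), h3 (i, j, true)).
    by move=> /= [-> ->]; case: (i == j).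
Qed.

(** A closed subset of the cube of coordinates in [-1, 1], which is compact by Tychonoff; the entry
    bounds place every POVM in this cube. *)
Lemma compact_povm_coords : compact povm_coords.
Proof.
apply: (@subclosed_compact _ _ [set f : space | forall t, `[-1, 1]%classic (f t)]).
- rewrite povm_coordsE; apply: closedI; first apply: closedI.
  + apply: closed_all => -[[[x i] j] b]; apply: closed_eq_continuous.
      exact: continuous_coord.
    apply: continuous_mulr; [exact: cst_continuous|exact: continuous_coord].
  + apply: closed_all => -[x v]; apply: closed_ge0_continuous.
    exact: continuous_retr.
  + apply: closed_all => -[[i j] b]; apply: closed_eq_continuous.
      by apply: continuous_sumr => x; exact: continuous_coord.
    exact: cst_continuous.
- apply: (@tychonoff coord (fun=> R) (fun=> `[-1, 1]%classic)) => t.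
  exact: segment_compact.
- move=> f pf [[[x i] j] b].
  have [] := psdmx_entry_le (pf.1 x) (povm_diag_le1 x i pf) (povm_diag_le1 x j pf).
  by rewrite !mxE /= in_itv /= -ler_norml; case: b.
Qed.

(** Extreme value theorem: the success probability is continuous in the coordinates, and the compact
    set of POVMs is nonempty. *)
Lemma guess_values_max (q : X -> R) (rho : X -> 'M[R[i]]_n) :
  (0 < #|X|)%N -> exists m, is_max (guess_values q rho) m.
Proof.
move=> X0; pose val (f : space) := \sum_x q x * retr (opfam_of_coord f x) (rho x).
have cval : continuous val.
  apply: continuous_sumr => x.
  by apply: continuous_mulr; [exact: cst_continuous|exact: continuous_retr].
have [|f] := @compact_EVT_max _ R val povm_coords _ compact_povm_coords
  (continuous_subspaceT cval).
  have [M pM] := @povm_exists R n X X0.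
  by exists (coord_of_opfam M); rewrite /povm_coords /= coord_of_opfamK.
rewrite inE => pf maxf; exists (val f); split; first by exists (opfam_of_coord f).
move=> _ [M [pM ->]]; have := maxf (coord_of_opfam M).
rewrite inE /val /povm_coords /= coord_of_opfamK; exact.
Qed.

End Compactness.

(** * The uniform prior and the identity between leakage and guessing *)

Lemma guess_value_uniform (R : realType) (n : nat) (X : finType)
    (rho M : X -> 'M[R[i]]_n) : (0 < #|X|)%N ->
  #|X|%:R * (\sum_x uniform_prior R x * retr (M x) (rho x))
  = \sum_x retr (M x) (rho x).
Proof. by move=> X0; rewrite -mulr_sumr mulVKf // pnatr_eq0 -lt0n. Qed.

Theorem mainTheorem2 (R : realType) (n : nat) (X : finType)
    (rho : X -> 'M[R[i]]_n) (hX : (0 < #|X|)%N)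
    (hrho : forall x : X, density (rho x)) :
  [/\ is_max (leakage_values rho) (maximal_leakage rho),
      is_max (guess_values (@uniform_prior R X) rho)
             (guess_prob (@uniform_prior R X) rho)
    & maximal_leakage rho
      = ln (#|X|%:R * guess_prob (@uniform_prior R X) rho)].
Proof.
have [m max_m] := guess_values_max (@uniform_prior R X) rho hX.
rewrite {1 2}/guess_prob (is_max_sup max_m).
have prho x : psdmx (rho x) by case: (hrho x).
have le_m M : povm M -> \sum_x retr (M x) (rho x) <= #|X|%:R * m.
  move=> pM; rewrite -(guess_value_uniform rho M hX) ler_wpM2l //.
  by case: max_m => _; apply; exists M.
(* Once ln(N m) is known to be a maximum of the leakage values, it is their supremum, which settles
   both remaining claims. *)
suff max_l : is_max (leakage_values rho) (ln (#|X|%:R * m)).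
  by rewrite /maximal_leakage (is_max_sup max_l).
have le_sum (Y : finType) (F : Y -> 'M[R[i]]_n) : povm F ->
    \sum_y \big[Num.max/0]_x retr (rho x) (F y) <= #|X|%:R * m.
  by move=> pF; have [M pM ->] := povm_leakage_sum_guess hX prho pF; exact: le_m.
split.
  have [[M [pM mE]] _] := max_m.
  (* An optimal guessing POVM, used as a measurement with outcomes in [X], attains the maximum: its
     leakage sum is at most N m by [le_sum] and at least N m by [guess_le_leakage_sum]. *)
  exists X, M; split=> //; congr ln; apply/eqP; rewrite eq_le le_sum // andbT.
  by rewrite mE guess_value_uniform // guess_le_leakage_sum.
move=> _ [Y [F [pF ->]]]; have ge1 := leakage_sum_ge1 hX hrho pF.
(* Monotonicity of [ln] is available only between positive arguments. *)
have gt0 : 0 < \sum_y \big[Num.max/0]_x retr (rho x) (F y).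
  exact: lt_le_trans ltr01 ge1.
by rewrite ler_ln ?posrE ?le_sum // (lt_le_trans gt0) // le_sum.
Qed.
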